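(* Let $$G(x,y;u)=1+\sum_{n\ge1}\Bigl(\sum_{\pi\in\mathfrak{S}_n}x^{\mathrm{des}(\pi)}y^{\mathrm{dez}(\pi)}\Bigr)u^n,\qquad F(t,s;u)=1+\sum_{n\geq 2}\Bigl(\sum_{\pi\in\mathcal{D}_n}t^{\mathrm{des}(\pi)}s^{\mathrm{xdes}(\pi)}\Bigr)u^n.$$ Then $$G(x,y;u)=\frac{1}{1-u}\times F\Bigl(\frac{xy}{1-u+xyu},\ \frac{(1-u+xu)(1-u+yu)}{1-u+xyu};\ u\bigl(1+\tfrac{xyu}{1-u}\bigr)\Bigr).$$
   Context: $\mathfrak{S}_n$ is the set of permutations of $[n]=\{1,\dots,n\}$ and $\mathcal{D}_n\subseteq\mathfrak{S}_n$ the set of derangements (no fixed points). For an integer word $w=w_1\cdots w_n$, $\mathrm{des}(w)=|\{i\in[n-1]:w_i>w_{i+1}\}|$. For $\pi\in\mathfrak{S}_n$, $\mathrm{dez}(\pi)=\mathrm{des}(w)$ where $w$ is obtained from $\pi_1\cdots\pi_n$ by replacing each fixed point value $\pi_i=i$ by $-1$ and then replacing every occurrence of the $j$-th smallest positive letter by $j$ for all $j$ (e.g. $\mathrm{dez}(41352)=\mathrm{des}(4\,1\,{-1}\,5\,2)=3$). An index $i$ is a crossing descent of $\pi$ if $\pi_i\ge i+1\ge\pi_{i+1}$, and $\mathrm{xdes}(\pi)$ is their number. *)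

(* Defs.v *)
From mathcomp Require Import all_boot all_order all_algebra all_fingroup.
Set Implicit Arguments. Unset Strict Implicit. Unset Printing Implicit Defensive.
Import Order.TTheory GRing.Theory Num.Theory.
Local Open Scope ring_scope.

(* ---------- permutation statistics (permutations of [n] encoded as 'S_n,
   position i+1 / value (p i)+1 correspond to the 0-based i / p i) ---------- *)

Definition des_word (w : seq int) : nat :=
  \sum_(i < (size w).-1) (nth 0 w i.+1 < nth 0 w i)%R.

Definition derangement n (p : 'S_n) : bool := [forall i, p i != i].

Definition des n (p : 'S_n) : nat :=
  des_word [seq ((p i).+1 : nat)%:Z | i <- enum 'I_n].

(* the word used for dez: fixed points replaced by -1, and the j-th smallest
   positive letter replaced by j (i.e. a non-fixed value is replaced by its rank
   among the non-fixed values) *)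
Definition dez_word n (p : 'S_n) : seq int :=
  [seq (if p i == i then (-1)%R
        else (#|[set j : 'I_n | (p j != j) && ((p j : nat) <= p i)%N]| : nat)%:Z)
  | i <- enum 'I_n].

Definition dez n (p : 'S_n) : nat := des_word (dez_word p).

(* crossing descents: 1-based indices i in [n-1] with pi_i >= i+1 >= pi_(i+1);
   in 0-based form i = k+1, pi_i = (p k).+1, pi_(i+1) = (p (k+1)).+1 *)
Definition xdes n (p : 'S_n) : nat :=
  \sum_(k < n)
    (if insub (k.+1) is Some k1 then
       [&& ((k.+1).+1 <= (p k).+1)%N & ((p k1).+1 <= (k.+1).+1)%N]
     else false : nat).

Section FPS.
Variable R : comUnitRingType.

Definition fps := nat -> R.

Definition fps_C (c : R) : fps := fun n => if n == 0%N then c else 0.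
Definition fps_X : fps := fun n => if n == 1%N then 1 else 0.
Definition fps_add (f g : fps) : fps := fun n => f n + g n.
Definition fps_opp (f : fps) : fps := fun n => - f n.
Definition fps_mul (f g : fps) : fps :=
  fun n => \sum_(i < n.+1) f i * g (n - i)%N.
Definition fps_pow (f : fps) (k : nat) : fps := iter k (fps_mul f) (fps_C 1).

(* multiplicative inverse of a series whose constant term is a unit:
   coefficients g_0 = f_0^-1, g_n = - f_0^-1 * sum_(1<=i<=n) f_i g_(n-i) *)
Fixpoint fps_inv_coefs (f : fps) (n : nat) : seq R :=
  match n with
  | 0 => [:: (f 0%N)^-1]
  | n'.+1 => let s := fps_inv_coefs f n' in
             rcons s (- (f 0%N)^-1 *
                      \sum_(1 <= i < n'.+2) f i * nth 0 s (n'.+1 - i)%N)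
  end.
Definition fps_inv (f : fps) : fps := fun n => nth 0 (fps_inv_coefs f n) n.

End FPS.

Definition G_series (R : comUnitRingType) (x y : R) : fps R :=
  fun m => if m == 0%N then 1
           else \sum_(p : 'S_m) x ^+ des p * y ^+ dez p.

(* F(T,S;U) = 1 + sum_(n>=2) (sum_(pi in D_n) T^des S^xdes) U^n, where T, S, U
   are formal power series in u and U has zero constant term, so that only
   n <= m contributes to the coefficient of u^m (formal composition). *)
Definition F_subst (R : comUnitRingType) (T S U : fps R) : fps R :=
  fun m => fps_C 1 m +
    \sum_(2 <= n < m.+1)
       \sum_(p : 'S_n | derangement p)
          fps_mul (fps_mul (fps_pow T (des p)) (fps_pow S (xdes p)))
                  (fps_pow U n) m.

(* Main.v *)
(* Deleting the fixed points turns a permutation of [m] into a derangement q of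
   [n] together with a way of inserting m - n fixed points into the gaps of q.
   The descents counted by des and dez can be read off gap by gap.  Put
   v = u / (1 - u).  The gap between positions i and i + 1 of q contributes
   - xy + x^2 y v = xy (1 + x v)  if i is an excedance and i + 1 is not (a crossing
     descent),
   - 1 + y v  if i is not an excedance and i + 1 is (a crossing ascent),
   - xy + xy v  or  1 + xy v  at the other descents, resp. ascents,
   and the two ends contribute 1 / (1 - u) and 1 + y v.  As q starts with an
   excedance and does not end with one, crossing ascents are one fewer than
   crossing descents, so that the factors 1 + y v can be distributed over the
   crossing descents.  The product is then T^des S^xdes U^n / (1 - u). *)

Require Import Defs.
From HB Require Import structures.
From mathcomp Require Import all_boot all_order all_algebra all_fingroup.
From mathcomp Require Import boolp ring zify.
Set Implicit Arguments. Unset Strict Implicit. Unset Printing Implicit Defensive.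
Import Order.TTheory GRing.Theory.
Local Open Scope ring_scope.

(** * Formal power series form a commutative ring *)

Section FormalPowerSeries.
Variable R : comUnitRingType.
Implicit Types f g h : fps R.

Lemma fpsP f g : f =1 g -> f = g.
Proof. by move/funext. Qed.

Definition fps_trunc N f : {poly R} := \poly_(i < N) f i.

(** Coefficients below [N] only see the truncations, so the ring laws of series are inherited from
    those of polynomials. *)
Lemma fps_mul_trunc N f g n : (n < N)%N ->
  fps_mul f g n = (fps_trunc N f * fps_trunc N g)`_n.
Proof.
move=> nN; rewrite coefM; apply: eq_bigr => i _.
by case: i => i /= lt_in; rewrite !coef_poly !ifT //; lia.
Qed.

Lemma fps_addA : associative (@fps_add R).
Proof. by move=> f g h; apply: fpsP => n; apply: addrA. Qed.

Lemma fps_addC : commutative (@fps_add R).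
Proof. by move=> f g; apply: fpsP => n; apply: addrC. Qed.

Lemma fps_add0 : left_id (fps_C 0) (@fps_add R).
Proof. by move=> f; apply: fpsP => n; rewrite /fps_add /fps_C if_same add0r. Qed.

Lemma fps_addN : left_inverse (fps_C 0) (@fps_opp R) (@fps_add R).
Proof.
by move=> f; apply: fpsP => n; rewrite /fps_add /fps_opp /fps_C if_same addNr.
Qed.

Lemma fps_mulC : commutative (@fps_mul R).
Proof.
by move=> f g; apply: fpsP => n; rewrite !(@fps_mul_trunc n.+1) // mulrC.
Qed.

Lemma fps_mulA : associative (@fps_mul R).
Proof.
move=> f g h; apply: fpsP => n; rewrite !(@fps_mul_trunc n.+1) //.
have trM f' g' i : (i < n.+1)%N ->
    (fps_trunc n.+1 (fps_mul f' g'))`_i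
    = (fps_trunc n.+1 f' * fps_trunc n.+1 g')`_i.
  by move=> lt_in; rewrite coef_poly lt_in (@fps_mul_trunc n.+1).
transitivity (fps_trunc n.+1 f * (fps_trunc n.+1 g * fps_trunc n.+1 h))`_n.
  by rewrite !coefM; apply: eq_bigr => -[i lt_in] _ /=; rewrite trM //; lia.
by rewrite mulrA !coefM; apply: eq_bigr => -[i lt_in] _ /=; rewrite trM //; lia.
Qed.

Lemma fps_mulCE (c : R) f n : fps_mul (fps_C c) f n = c * f n.
Proof.
rewrite /fps_mul big_ord_recl /= subn0 big1 ?addr0 // => i _.
by rewrite /fps_C /= mul0r.
Qed.

Lemma fps_mul1 : left_id (fps_C 1) (@fps_mul R).
Proof. by move=> f; apply: fpsP => n; rewrite fps_mulCE mul1r. Qed.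

Lemma fps_mulDl : left_distributive (@fps_mul R) (@fps_add R).
Proof.
move=> f g h; apply: fpsP => n; rewrite /fps_mul /fps_add -big_split /=.
by apply: eq_bigr => i _; rewrite mulrDl.
Qed.

HB.instance Definition _ := gen_eqMixin (fps R).
HB.instance Definition _ := gen_choiceMixin (fps R).
HB.instance Definition _ :=
  GRing.isZmodule.Build (fps R) fps_addA fps_addC fps_add0 fps_addN.

Lemma fps_oner_neq0 : fps_C 1 != 0 :> fps R.
Proof. by apply/eqP => /(congr1 (fun f => f 0%N)); apply/eqP/oner_neq0. Qed.

HB.instance Definition _ := GRing.Zmodule_isComNzRing.Build (fps R)
  fps_mulA fps_mulC fps_mul1 fps_mulDl fps_oner_neq0.

Lemma fps_coefD f g n : (f + g) n = f n + g n. Proof. by []. Qed.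

Lemma fps_coefM f g n : (f * g) n = \sum_(i < n.+1) f i * g (n - i)%N.
Proof. by []. Qed.

Lemma fps_coef_sum I (r : seq I) (P : pred I) (F : I -> fps R) n :
  (\sum_(i <- r | P i) F i) n = \sum_(i <- r | P i) F i n.
Proof.
apply: (big_morph (fun f : fps R => f n)) => //.
by rewrite /GRing.zero /= /fps_C if_same.
Qed.

Lemma fps_coefCM (c : R) f n : ((fps_C c : fps R) * f) n = c * f n.
Proof. exact: fps_mulCE. Qed.

Lemma fps_coefX0 f : ((fps_X R : fps R) * f) 0%N = 0.
Proof. by rewrite fps_coefM big_ord1 mul0r. Qed.

Lemma fps_coefXS f n : ((fps_X R : fps R) * f) n.+1 = f n.
Proof.
rewrite fps_coefM big_ord_recl mul0r add0r.
rewrite big_ord_recl /= mul1r subSS subn0 big1 ?addr0 // => i _.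
by rewrite mul0r.
Qed.

Lemma fps_CM (c d : R) : fps_C (c * d) = (fps_C c : fps R) * fps_C d.
Proof.
by apply: fpsP => n; rewrite fps_coefCM /fps_C; case: eqP; rewrite ?mulr0.
Qed.

Lemma fps_powE f k : fps_pow f k = f ^+ k.
Proof. by elim: k => // k IH; rewrite exprS -IH. Qed.

(** Each factor [f] raises the order by at least one. This makes the composition with [U] a finite
    sum in each coefficient. *)
Lemma fps_coefM_lt f g h k n : f 0%N = 0 -> (n < k)%N -> (g * f ^+ k) n = 0.
Proof.
move=> f0; elim: k n g => // k IH n g; rewrite ltnS exprSr mulrA => le_nk.
rewrite mulrC fps_coefM big_ord_recl f0 mul0r add0r big1 // => i _.
by case: i => i lt_in /=; rewrite IH ?mulr0 // /bump /=; lia.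
Qed.

Lemma size_fps_inv_coefs f n : size (fps_inv_coefs f n) = n.+1.
Proof. by elim: n => //= n IH; rewrite size_rcons IH. Qed.

Lemma nth_fps_inv_coefs f n i : (i <= n)%N ->
  nth 0 (fps_inv_coefs f n) i = fps_inv f i.
Proof.
elim: n => [|n IH]; first by case: i.
rewrite leq_eqVlt => /predU1P[-> // | lt_in].
by rewrite /= nth_rcons size_fps_inv_coefs lt_in IH.
Qed.

Lemma fps_mulVf f : f 0%N \is a GRing.unit -> fps_inv f * f = 1.
Proof.
move=> Uf; rewrite mulrC; apply: fpsP => -[|n].
  by rewrite fps_coefM big_ord1 divrr.
rewrite fps_coefM big_ord_recl /= subn0.
have ->: fps_inv f n.+1
    = - (f 0%N)^-1 * \sum_(i < n.+1) f i.+1 * fps_inv f (n - i)%N.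
  rewrite {1}/fps_inv /= nth_rcons size_fps_inv_coefs ltnn eqxx.
  rewrite big_add1 /= big_mkord; congr (_ * _); apply: eq_bigr => i _.
  by rewrite subSS nth_fps_inv_coefs ?leq_subr.
by rewrite mulNr mulrN mulVKr // addNr.
Qed.

End FormalPowerSeries.

(** * Inserting fixed points into a derangement *)

Section Scan.
Variables (R : comUnitRingType) (x y : R) (s : nat -> nat).

(* A permutation is scanned from left to right, its fixed points being inserted
   into the derangement [s].  [i] letters of [s] have been read so far; [a] and
   [c] tell whether the previous and the current position carry a letter of [s]
   rather than a fixed point. *)
Definition step (i : nat) (a c : bool) : R :=
  if c then
    if a then (x * y) ^+ (s i < s i.-1)%N else x ^+ (s i < i)%N
  else if a then y * x ^+ (i.-1 < s i.-1)%N else 1.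

(** In [step], a fixed point right after a letter always gives a descent of the [dez] word, where it
    reads -1, and one right before a letter never does; for [des] only the side of the diagonal on
    which the letter lies matters. Two letters descend for both statistics or for neither, two fixed
    points for neither. *)
Fixpoint weight (i : nat) (a : bool) (b : bitseq) : R :=
  if b is c :: b' then step i a c * weight (i + c)%N c b' else 1.

Lemma weightE i a b : weight i a b =
  \prod_(j < size b)
    step (i + count id (take j b))%N (nth false (a :: b) j) (nth false b j).
Proof.
elim: b i a => [|c b IH] i a; first by rewrite big_ord0.
rewrite big_ord_recl /= addn0 IH; congr (_ * _).
by apply: eq_bigr => j _ /=; rewrite addnA.
Qed.

Variable n : nat.

Definition insertion_series (i : nat) (a : bool) : fps R := fun m =>
  \sum_(b : m.-tuple bool | (i + count id b)%N == n) weight i a b.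

(** Split on the first bit; the empty word counts only when all [n] letters have been read. *)
Lemma insertion_series_rec i a : insertion_series i a =
  (i == n)%:R + (fps_X R : fps R) *
    (fps_C (step i a true) * insertion_series i.+1 true
     + fps_C (step i a false) * insertion_series i false).
Proof.
have -> : (i == n)%:R = fps_C (i == n)%:R :> fps R by case: eqP.
apply: fpsP => -[|m]; rewrite fps_coefD {1}/fps_C /=.
  rewrite fps_coefX0 addr0 /insertion_series.
  rewrite (eq_bigl (fun b => i == n)); last first.
    by move=> b; rewrite (tuple0 b) /= addn0.
  rewrite big_mkcond (bigD1 [tuple]) //= big1 ?addr0; last first.
    by move=> b /negP[]; apply/eqP; rewrite tuple0.
  by case: eqP.
rewrite fps_coefXS add0r fps_coefD !fps_coefCM /insertion_series.
have cons_bij : bijective (fun cb : bool * m.-tuple bool => [tuple of cb.1 :: cb.2]).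
  exists (fun b => (thead b, [tuple of behead b])) => [[c b]|b] /=.
    by congr (_, _); apply: val_inj.
  by rewrite -tuple_eta.
rewrite (reindex _ (onW_bij _ cons_bij)) /=.
rewrite -(pair_big_dep predT (fun (c : bool) (b : m.-tuple bool) =>
    (i + (c + count id b))%N == n)
  (fun c b => step i a c * weight (i + c)%N c b)) /=.
rewrite big_bool /= !big_distrr /= addn0 addn1.
by congr (_ + _); apply: eq_bigl => b; rewrite /= ?addnA ?addn1 ?addn0.
Qed.

Lemma insertion_series_gt i a : (n < i)%N -> insertion_series i a = 0.
Proof.
move=> lt_ni; apply: fpsP => m; rewrite /insertion_series big_pred0.
  by rewrite /GRing.zero /= /fps_C if_same.
by move=> b; apply/negbTE; lia.
Qed.

(** * Closed form of the insertion series *)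

Hypothesis s_lt : forall i, (i < n)%N -> (s i < n)%N.
Hypothesis s_neq : forall i, (i < n)%N -> s i != i.

Local Notation u := (fps_X R : fps R).
Local Notation c a := (fps_C a : fps R).
Local Notation den := (1 - u + c (x * y) * u).
Local Notation V := (fps_inv (1 - u : fps R) : fps R).
Local Notation D := (fps_inv (den : fps R) : fps R).
Local Notation T := (c (x * y) * D).
Local Notation S := ((1 - u + c x * u) * (1 - u + c y * u) * D).
Local Notation K := (1 + c (x * y) * u * V).

Lemma geom_inv : V * (1 - u) = 1.
Proof.
apply: fps_mulVf; rewrite /GRing.add /= /fps_add /GRing.opp /= /fps_opp /fps_X /=.
by rewrite oppr0 addr0 unitr1.
Qed.

Lemma den_inv : D * den = 1.
Proof.
apply: fps_mulVf; rewrite mulrC fps_coefD fps_coefX0 addr0.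
rewrite /GRing.add /= /fps_add /GRing.opp /= /fps_opp /fps_X /=.
by rewrite oppr0 addr0 unitr1.
Qed.

(** Here [u * K] is the [U] of the theorem. Multiplying [T] or [S] by [K] cancels [den] and leaves
    only the geometric series [V]. *)
Lemma K_eq : K = V * den.
Proof. by rewrite mulrDr geom_inv; ring. Qed.

Lemma KT_eq : K * T = c (x * y) * V.
Proof. by rewrite K_eq -[RHS]mulr1 -[X in _ = _ * X]den_inv; ring. Qed.

Lemma KS_eq : K * S = (1 - u + c x * u) * (1 - u + c y * u) * V.
Proof. by rewrite K_eq -[RHS]mulr1 -[X in _ = _ * X]den_inv; ring. Qed.

Lemma geom_shift (a : fps R) : 1 + a * u * V = (1 - u + a * u) * V.
Proof. by rewrite -[X in X + _]geom_inv; ring. Qed.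

Lemma insertion_series_end : insertion_series n false = V.
Proof.
have := insertion_series_rec n false.
rewrite (@insertion_series_gt n.+1) // mulr0 add0r eqxx /= (_ : c 1 = 1) // => E.
have {}E : insertion_series n false * (1 - u) = 1.
  by rewrite mulrBr mulr1 {1}E; ring.
by rewrite -[LHS]mulr1 -[X in _ * X]geom_inv [V * _]mulrC mulrA E mul1r.
Qed.

(** A further run of fixed points of any length, summing to [V], comes before the letter [s i],
    which then follows a fixed point. *)
Lemma insertion_series_fixed i : (i < n)%N ->
  insertion_series i false
  = V * u * c (x ^+ (s i < i)%N) * insertion_series i.+1 true.
Proof.
move=> lt_in; have := insertion_series_rec i false.
rewrite (ltn_eqF lt_in) /= (_ : c 1 = 1) // => E.
have {}E : insertion_series i false * (1 - u)
    = u * c (x ^+ (s i < i)%N) * insertion_series i.+1 true.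
  by rewrite mulrBr mulr1 {1}E; ring.
by rewrite -[LHS]mulr1 -[X in _ * X]geom_inv [V * _]mulrC mulrA E; ring.
Qed.

Definition des_from k := (\sum_(k <= j < n.-1) (s j.+1 < s j))%N.
Definition xdes_from k :=
  (\sum_(k <= j < n.-1) ((j < s j) && (s j.+1 <= j.+1)))%N.

(** Backward induction on [k]. The last factor is pending: read from right to left, the end of the
    word and each crossing ascent supply [1 + c y * u * V], which the next crossing descent
    consumes, leaving [K]. *)
Lemma insertion_series_letter k : (k < n)%N ->
  insertion_series k.+1 true =
  T ^+ des_from k * S ^+ xdes_from k * (u * K) ^+ (n.-1 - k)
  * (if (k < s k)%N then K else 1 + c y * u * V).
Proof.
move=> lt_kn; have [d] : {d | n.-1 - k = d}%N by exists (n.-1 - k)%N.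
elim: d k lt_kn => [|d IH] k lt_kn dE.
  have kE : k.+1 = n by lia.
  rewrite /des_from /xdes_from !big_geq ?dE; try lia.
  (* The last letter cannot be an excedance: [s k] is below [n = k.+1] and differs from [k]. *)
  have -> : (k < s k)%N = false.
    by have := s_lt lt_kn; have := s_neq lt_kn; lia.
  rewrite insertion_series_rec kE eqxx (@insertion_series_gt n.+1) // mulr0 add0r.
  rewrite insertion_series_end.
  have -> : step n true false = y.
    rewrite /step -kE /=; have -> : (k < s k)%N = false.
      by have := s_lt lt_kn; have := s_neq lt_kn; lia.
    by rewrite mulr1.
  by rewrite !expr0 mulr1n; ring.
have lt_k1n : (k.+1 < n)%N by lia.
have := s_neq lt_kn; have := s_neq lt_k1n => neq1 neq0.
rewrite insertion_series_rec (ltn_eqF lt_k1n) insertion_series_fixed //.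
rewrite IH //; last lia.
rewrite [des_from k]big_ltn ?[xdes_from k]big_ltn; try lia.
rewrite -/(des_from k.+1) -/(xdes_from k.+1) dE.
rewrite (_ : n.-1 - k.+1 = d)%N; last lia.
rewrite !exprD [(u * K) ^+ d.+1]exprS.
set P := T ^+ des_from k.+1; set Q := S ^+ _; set W := (_ ^+ d).
set a := step _ _ _; set b := step _ _ _; set B := 1 + c y * u * V.
set G := if (k.+1 < _)%N then _ else _; set H := if _ then _ else _.
set t := T ^+ _; set r := S ^+ _; set f := x ^+ _.
(* Without the common factors, only the gap after letter [k] remains: the next letter follows at
   once ([a]) or after a nonempty run of fixed points ([b]). *)
suff local : c a * G + c b * (V * u * c f * G) = t * r * K * H.
  transitivity (u * P * Q * W * (c a * G + c b * (V * u * c f * G))).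
    by rewrite add0r; ring.
  by rewrite local; ring.
have nexc j : s j != j -> (s j <= j)%N = ~~ (j < s j)%N by lia.
have nexc' j : s j != j -> (s j < j)%N = ~~ (j < s j)%N by lia.
rewrite {}/a {}/b {}/G {}/H {}/t {}/r {}/f /step [_.+1.-1]/=.
rewrite nexc // nexc' //.
have KS' :
    T * S * K * K = c (x * y) * V * ((1 - u + c x * u) * V) * ((1 - u + c y * u)).
  transitivity ((K * T) * (K * S)); first by ring.
  by rewrite KT_eq KS_eq; ring.
(* The gap between two letters on the same side of the diagonal, with [z] telling whether it is a
   descent. *)
have noncross (z : bool) : c ((x * y) ^+ z) + c (x * y) * u * V = K * T ^+ z.
  case: z; rewrite ?expr0 ?mulr1 // !expr1 KT_eq.
  by rewrite -[X in X + _]mulr1 -[X in _ * X + _]geom_inv; ring.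
have c1 : c 1 = 1 by [].
case: (ltnP k (s k)) => e; case: (ltnP k.+1 (s k.+1)) => e' /=.
- rewrite expr1 !expr0 c1 -[y * x]mulrC.
  transitivity ((c ((x * y) ^+ (s k.+1 < s k)%N) + c (x * y) * u * V) * K).
    by ring.
  by rewrite noncross; ring.
(* A crossing descent is a true descent, as [s k.+1 <= k < s k]; dually, the crossing ascent in the
   next case is a true ascent. *)
- have -> : (s k.+1 < s k)%N by lia.
  rewrite !expr1 mulrC [y * x]mulrC.
  transitivity (c (x * y) * (1 + c x * u * V) * B); first by ring.
  transitivity (T * S * K * K); last by ring.
  by rewrite KS' /B !geom_shift; ring.
- have -> : (s k.+1 < s k)%N = false by lia.
  by rewrite !expr0 !(mulr1 (y : R)) c1 /B; ring.
- rewrite !expr0 expr1 !(mulr1 (y : R)) -/B.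
  transitivity ((c ((x * y) ^+ (s k.+1 < s k)%N) + c (x * y) * u * V) * B).
    by rewrite [c (x * y)]fps_CM; ring.
  by rewrite noncross; ring.
Qed.

(** The first letter is an excedance, so the pending factor is [K], which completes the [n]-th power
    of [u * K]; [V] counts the fixed points in front. *)
Lemma insertion_seriesE : insertion_series 0 false =
  V * (T ^+ des_from 0 * S ^+ xdes_from 0 * (u * K) ^+ n).
Proof.
case: (posnP n) => [n0|n_gt0].
  rewrite /des_from /xdes_from !big_geq ?n0 // !expr0 !mulr1.
  by rewrite -[X in insertion_series X]n0 insertion_series_end.
rewrite insertion_series_fixed // insertion_series_letter //.
have -> : (0 < s 0)%N by rewrite lt0n; apply: s_neq.
rewrite expr0 (_ : c 1 = 1) // subn0 -[in RHS](prednK n_gt0) exprS.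
by ring.
Qed.

End Scan.

(** * Permutations with a given set of fixed points *)

(** Total on [nat], as the scan requires; the value 0 outside [[0, n)] is a dummy. *)
Definition perm_nat n (p : 'S_n) (k : nat) : nat :=
  if insub k is Some i then p i else 0%N.

Lemma perm_natE n (p : 'S_n) (i : 'I_n) : perm_nat p i = p i.
Proof. by rewrite /perm_nat valK. Qed.

Lemma des_word_map m (f : 'I_m -> int) (d : nat -> bool) :
    (forall i j : 'I_m, j = i.+1 :> nat -> (f j < f i) = d i) ->
  des_word [seq f i | i <- enum 'I_m] = (\sum_(k < m.-1) d k)%N.
Proof.
move=> fd; rewrite /des_word size_map size_enum_ord; apply: eq_bigr => -[k lt_k] _.
have lt_k1m : (k.+1 < m)%N by lia.
have lt_km := ltnW lt_k1m.
have nthE i (lt_im : (i < m)%N) :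
    nth 0 [seq f i | i <- enum 'I_m] i = f (Ordinal lt_im).
  rewrite (nth_map (Ordinal lt_im)) ?size_enum_ord //; congr f.
  by apply: val_inj; rewrite /= nth_enum_ord.
congr nat_of_bool; rewrite -(fd (Ordinal lt_km) (Ordinal lt_k1m)) //.
by rewrite (nthE _ lt_km) (nthE _ lt_k1m).
Qed.

Lemma desE n (p : 'S_n) : des p = des_from (perm_nat p) n 0.
Proof.
rewrite /des_from big_mkord.
apply: (des_word_map (d := fun k => perm_nat p k.+1 < perm_nat p k)%N) => i j ij.
by rewrite -ij !perm_natE ltz_nat ltnS.
Qed.

Lemma xdesE n (p : 'S_n) : xdes p = xdes_from (perm_nat p) n 0.
Proof.
rewrite /xdes_from big_mkord /xdes; case: n p => [|n] p; first by rewrite !big_ord0.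
(* The last index has no successor: [insub] fails there and the term is 0. *)
rewrite big_ord_recr /= insubN ?ltnn // addn0; apply: eq_bigr => k _.
rewrite -(perm_natE p (widen_ord _ k)) /= insubT ?ltnS // => lt_k.
by rewrite -(perm_natE p (Sub k.+1 lt_k)).
Qed.

(** Ranks compare like values because the sets counted are nested, strictly so since [i] lies in its
    own set but not in that of a smaller value. *)
Lemma dez_letter_lt m (p : 'S_m) (i j : 'I_m) :
  let letter i := (if p i == i then (-1)%R
    else (#|[set j : 'I_m | (p j != j) && ((p j : nat) <= p i)%N]| : nat)%:Z) in
  (letter j < letter i) = (p i != i) && ((p j == j) || (p j < p i)%N).
Proof.
move=> letter; rewrite /letter.
case: (eqVneq (p i) i) => pi; case: (eqVneq (p j) j) => pj //=.
rewrite ltz_nat; apply/idP/idP => [|lt_ji].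
  apply: contraTT; rewrite -leqNgt => le_ij; rewrite -leqNgt.
  apply/subset_leq_card/subsetP => k; rewrite !inE => /andP[-> le_k] /=.
  exact: leq_trans le_ij.
apply/proper_card/properP; split.
  apply/subsetP => k; rewrite !inE => /andP[-> le_k] /=.
  by apply: leq_trans le_k _; apply: ltnW.
by exists i; rewrite !inE ?pi ?leqnn //= -ltnNge.
Qed.

Lemma dezE m (p : 'S_m) (d : nat -> bool) :
    (forall i j : 'I_m, j = i.+1 :> nat ->
      (p i != i) && ((p j == j) || (p j < p i)%N) = d i) ->
  dez p = (\sum_(k < m.-1) d k)%N.
Proof.
by move=> pd; apply: des_word_map => i j ij; rewrite dez_letter_lt pd.
Qed.

(** * Extending a derangement by fixed points along an order embedding *)

Section Extension.
Variables (n m : nat) (h : 'I_n -> 'I_m).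
Hypothesis h_mono : forall i j, (h i < h j)%N = (i < j)%N.

Lemma mono_inj : injective h.
Proof.
move=> i j eq_h; apply: ord_inj.
by have := h_mono i j; have := h_mono j i; rewrite eq_h ltnn; lia.
Qed.

Definition extend_fun (q : 'S_n) (j : 'I_m) : 'I_m :=
  if [pick i | h i == j] is Some i then h (q i) else j.

Lemma extend_fun_codom q i : extend_fun q (h i) = h (q i).
Proof.
rewrite /extend_fun; case: pickP => [i' /eqP/mono_inj-> //|/(_ i)].
by rewrite eqxx.
Qed.

Lemma extend_fun_out q j : j \notin codom h -> extend_fun q j = j.
Proof.
rewrite /extend_fun; case: pickP => [i /eqP<-|//].
by rewrite codom_f.
Qed.

Lemma extend_fun_inj q : injective (extend_fun q).
Proof.
move=> j k.
case: (boolP (j \in codom h)) => [/codomP[i ->]|jN];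
  case: (boolP (k \in codom h)) => [/codomP[i' ->]|kN];
  rewrite ?extend_fun_codom ?extend_fun_out //.
- by move=> /mono_inj/perm_inj->.
- by move=> E; rewrite -E codom_f in kN.
- by move=> E; rewrite E codom_f in jN.
Qed.

Definition extend q : 'S_m := perm (@extend_fun_inj q).

Lemma extend_codom q i : extend q (h i) = h (q i).
Proof. by rewrite permE extend_fun_codom. Qed.

Lemma extend_out q j : j \notin codom h -> extend q j = j.
Proof. by move=> jN; rewrite permE extend_fun_out. Qed.

Lemma extend_fixed q j : derangement q -> (extend q j != j) = (j \in codom h).
Proof.
move=> /forallP q_der; case: (boolP (j \in codom h)) => [/codomP[i ->]|jN].
  by rewrite extend_codom (inj_eq mono_inj) q_der.
by rewrite extend_out ?eqxx.
Qed.

Lemma extend_inj : injective extend.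
Proof.
move=> q q' E; apply/permP => i.
by apply: mono_inj; rewrite -!extend_codom E.
Qed.

(** By injectivity [p] maps non-fixed points to non-fixed points, so it restricts to the image of
    [h] and pulls back along [h]. *)
Lemma extend_onto (p : 'S_m) : (forall j, (p j != j) = (j \in codom h)) ->
  exists2 q, derangement q & p = extend q.
Proof.
move=> pP; have in_codom i : p (h i) \in codom h.
  by rewrite -pP (inj_eq perm_inj) pP codom_f.
pose f i := iinv (in_codom i).
have hf i : h (f i) = p (h i) by apply: f_iinv.
have f_inj : injective f.
  by move=> i j E; apply/mono_inj/(@perm_inj _ p); rewrite -!hf E.
exists (perm f_inj).
  by apply/forallP => i; rewrite permE -(inj_eq mono_inj) hf pP codom_f.
apply/permP => j; case: (boolP (j \in codom h)) => [/codomP[i ->]|jN].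
  by rewrite extend_codom permE hf.
by rewrite extend_out //; apply/eqP; rewrite -[_ == _]negbK pP.
Qed.

Lemma sum_extend (V : nmodType) (F : 'S_m -> V) :
  \sum_(p : 'S_m | [forall j, (p j != j) == (j \in codom h)]) F p
  = \sum_(q : 'S_n | derangement q) F (extend q).
Proof.
rewrite -(big_imset (h := extend) (A := [pred q | derangement q]) F); last first.
  by move=> q q' _ _; apply: extend_inj.
apply: eq_bigl => p; apply/forallP/imsetP => [pP|[q q_der ->] j].
  have [q q_der ->] := extend_onto (fun j => eqP (pP j)).
  by exists q.
by rewrite extend_fixed.
Qed.

Variable b : m.-tuple bool.
Hypothesis bE : forall j, tnth b j = (j \in codom h).

Lemma nth_codom (j : 'I_m) : nth false b j = (j \in codom h).
Proof. by rewrite -bE (tnth_nth false). Qed.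

Lemma count_take_codom k : (k <= m)%N ->
  count id (take k b) = (\sum_(i < n) (h i < k))%N.
Proof.
elim: k => [|k IH] le_km; first by rewrite take0 big1.
rewrite (take_nth false) ?size_tuple // -cats1 count_cat IH ?(ltnW le_km) //=.
rewrite addn0 (nth_codom (Ordinal le_km)).
transitivity (\sum_(i < n) ((h i < k) + (h i == k :> nat)))%N; last first.
  by apply: eq_bigr => i _; rewrite [in RHS]ltnS; case: (ltngtP (h i) k).
rewrite big_split /=; congr addn.
case: (boolP (_ \in _)) => [/codomP[i hi]|kN].
  have {}hi : h i = k :> nat by rewrite -hi.
  rewrite (bigD1 i) //= hi eqxx big1 // => i' /negbTE ne.
  by rewrite -hi (inj_eq val_inj) (inj_eq mono_inj) ne.
rewrite big1 // => i _; case: eqP => // hi; case/negP: kN.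
by apply/codomP; exists i; apply: val_inj.
Qed.

(** When the scan reaches position [h i], exactly the letters before [i] have been read. *)
Lemma count_take_h i : count id (take (h i) b) = i.
Proof.
rewrite count_take_codom; last exact: ltnW.
rewrite (eq_bigr (fun j : 'I_n => (j < i)%N : nat)) => [|j _]; last by rewrite h_mono.
have -> k : (\sum_(j < k) (j < i))%N = minn k i.
  by elim: k => [|k IH]; rewrite ?big_ord0 ?big_ord_recr /= ?IH; lia.
by apply/minn_idPr/ltnW.
Qed.

(** Both sides are compared factor by factor over adjacent positions, by whether each of the two
    lies in the image of [h]. *)
Lemma weight_extend (R : comUnitRingType) (x y : R) q : derangement q ->
  x ^+ des (extend q) * y ^+ dez (extend q) = weight x y (perm_nat q) 0 false b.
Proof.
move=> q_der; pose p := extend q.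
pose dd k :=
  nth false b k && (~~ nth false b k.+1 || (perm_nat p k.+1 < perm_nat p k))%N.
have -> : dez p = (\sum_(k < m.-1) dd k)%N.
  apply: dezE => i j ij; rewrite /dd -ij !perm_natE !nth_codom.
  by rewrite -!(extend_fixed _ q_der) negbK.
rewrite desE /des_from big_mkord !expr_sum -big_split weightE size_tuple.
rewrite -[RHS](big_mkord xpredT (fun j =>
  step x y (perm_nat q) (0 + count id (take j b))%N
    (nth false (false :: b) j) (nth false b j))).
have [m0|m_gt0] := posnP m.
  by rewrite [RHS]big_geq ?m0 // big1 // => -[k lt_k]; exfalso; lia.
(* Position 0 has no predecessor; its factor is 1, as [s 0 < 0] is false. *)
rewrite [RHS]big_ltn // take0 /step if_same mul1r big_add1 big_mkord.
apply: eq_bigr => -[k /= lt_k] _; rewrite add0n.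
have lt_k1m : (k.+1 < m)%N by lia.
have lt_km := ltnW lt_k1m.
rewrite /dd; pose j0 := Ordinal lt_km; pose j1 := Ordinal lt_k1m.
rewrite (perm_natE p j0 : perm_nat p k = p j0).
rewrite (perm_natE p j1 : perm_nat p k.+1 = p j1).
rewrite (nth_codom j0 : nth false b k = _) (nth_codom j1 : nth false b k.+1 = _).
have count_succ :
    count id (take k.+1 b) = (count id (take k b) + (j0 \in codom h))%N.
  rewrite (take_nth false) ?size_tuple // -cats1 count_cat /= addn0.
  by rewrite (nth_codom j0).
case: (boolP (j0 \in codom h)) count_succ => [/codomP[i0 hi0]|j0N];
  case: (boolP (j1 \in codom h)) => [/codomP[i1 hi1]|j1N] /=.
- have c0 : count id (take k b) = i0 by rewrite -(count_take_h i0) -hi0.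
  have c1 : count id (take k.+1 b) = i1 by rewrite -(count_take_h i1) -hi1.
  rewrite c0 c1 addn1 => i01.
  rewrite hi0 hi1 !extend_codom h_mono i01 [_.+1.-1]/= -i01.
  by rewrite !perm_natE exprMn.
- have c0 : count id (take k b) = i0 by rewrite -(count_take_h i0) -hi0.
  rewrite c0 => ->; rewrite addn1 perm_natE expr1 mulrC.
  congr (_ * x ^+ nat_of_bool _).
  rewrite [p j1]extend_out // hi0 [p _]extend_codom -h_mono -hi0 /=.
  (* Since [h (q i0)] is not the fixed point [k.+1], exceeding [k.+1] amounts to exceeding
     [k = h i0], hence to [i0 < q i0]. *)
  have : h (q i0) != j1 by apply: contraNneq j1N => <-; apply: codom_f.
  by rewrite -(inj_eq val_inj) /=; lia.
- have -> : count id (take k.+1 b) = i1 by rewrite -(count_take_h i1) -hi1.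
  rewrite perm_natE expr0 mulr1 => _; congr (x ^+ nat_of_bool _).
  rewrite [p j0]extend_out // hi1 [p _]extend_codom -h_mono -hi1 /=.
  have : h (q i1) != j0 by apply: contraNneq j0N => <-; apply: codom_f.
  by rewrite -(inj_eq val_inj) /=; lia.
- by rewrite [p j0]extend_out // [p j1]extend_out //= ltnNge leqnSn !expr0 mulr1.
Qed.
End Extension.

Lemma ltn_enum_val m (A : {set 'I_m}) (i j : 'I_#|A|) :
  (enum_val i < enum_val j)%N = (i < j)%N.
Proof.
have A_sorted : sorted ltn [seq val k | k <- enum A].
  rewrite -[enum _](eq_filter (mem_enum _)).
  rewrite -(eq_filter (mem_map val_inj _)) -filter_map.
  by rewrite (sorted_filter ltn_trans) // unlock val_ord_enum iota_ltn_sorted.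
have homo (k l : 'I_#|A|) : (k < l)%N -> (enum_val k < enum_val l)%N.
  move=> lt_kl; pose d := enum_val k.
  rewrite !(enum_val_nth d) -!(nth_map d 0%N val) -?cardE //.
  by rewrite (sorted_ltn_nth ltn_trans) // inE size_map -cardE.
by case: (ltngtP i j) => [/homo //|/homo/ltnW|/ord_inj->];
  rewrite ?ltnn // ltnNge => ->.
Qed.

(** The increasing enumeration of the positions marked by [b] serves as the embedding [h]. *)
Lemma sum_support (R : comUnitRingType) (x y : R) n m (b : m.-tuple bool) :
  count id b = n ->
  \sum_(p : 'S_m | [tuple p i != i | i < m] == b) x ^+ des p * y ^+ dez p
  = \sum_(q : 'S_n | derangement q) weight x y (perm_nat q) 0 false b.
Proof.
move=> bn; pose A := [set i | tnth b i].
have cardA : #|A| = n.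
  rewrite -bn -sum1_count big_tuple -sum1_card.
  by apply: eq_bigl => i; rewrite inE.
pose h (i : 'I_n) := enum_val (cast_ord (esym cardA) i).
have h_mono i j : (h i < h j)%N = (i < j)%N by rewrite ltn_enum_val.
have bE j : tnth b j = (j \in codom h).
  apply/idP/codomP => [bj|[i ->]]; last first.
    by have := enum_valP (cast_ord (esym cardA) i); rewrite inE.
  have Aj : j \in A by rewrite inE.
  exists (cast_ord cardA (enum_rank_in Aj j)).
  by rewrite /h cast_ordK enum_rankK_in.
transitivity (\sum_(p : 'S_m | [forall j, (p j != j) == (j \in codom h)])
    x ^+ des p * y ^+ dez p).
  apply: eq_bigl => p; apply/eqP/forallP => [pb j|pP].
    by rewrite -bE -pb tnth_mktuple.
  by apply: eq_from_tnth => j; rewrite tnth_mktuple (eqP (pP j)) bE.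
rewrite (sum_extend h_mono); apply: eq_bigr => q q_der.
exact: weight_extend.
Qed.

Lemma perm_nat_lt n (p : 'S_n) i : (i < n)%N -> (perm_nat p i < n)%N.
Proof. by move=> lt_in; rewrite (perm_natE p (Ordinal lt_in)). Qed.

Lemma perm_nat_neq n (p : 'S_n) i :
  derangement p -> (i < n)%N -> perm_nat p i != i.
Proof.
by move=> /forallP p_der lt_in; rewrite (perm_natE p (Ordinal lt_in)); apply: p_der.
Qed.

(** * Assembling the generating functions *)

Lemma big_perm0 (V : nmodType) (P : pred 'S_0) (F : 'S_0 -> V) :
  \sum_(p | P p) F p = if P 1%g then F 1%g else 0.
Proof.
rewrite big_mkcond (bigD1 1%g) //= big1 ?addr0 // => p /negP[].
by apply/eqP/permP => -[].
Qed.

Theorem theorem3p2 (R : comUnitRingType) (x y : R) :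
  let one : fps R := fps_C 1 in
  let u : fps R := fps_X R in
  let c (a : R) : fps R := fps_C a in
  let one_m_u := fps_add one (fps_opp u) in                    (* 1 - u *)
  let den := fps_add one_m_u (fps_mul (c (x * y)) u) in        (* 1 - u + xyu *)
  let T := fps_mul (c (x * y)) (fps_inv den) in
  let S := fps_mul (fps_mul (fps_add one_m_u (fps_mul (c x) u))
                            (fps_add one_m_u (fps_mul (c y) u)))
                   (fps_inv den) in
  let U := fps_mul u (fps_add one (fps_mul (fps_mul (c (x * y)) u)
                                          (fps_inv one_m_u))) in
  forall m : nat,
    G_series x y m = fps_mul (fps_inv one_m_u) (F_subst T S U) m.
Proof.
move=> one u c one_m_u den T S U m; pose V := fps_inv one_m_u.
pose term n (q : 'S_n) : fps R := T ^+ des q * S ^+ xdes q * U ^+ n.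
have sum_term : G_series x y m
    = \sum_(0 <= n < m.+1) \sum_(q : 'S_n | derangement q) (V * term n q) m.
  transitivity (\sum_(p : 'S_m) x ^+ des p * y ^+ dez p).
    rewrite /G_series; case: eqP => // ->; rewrite big_perm0.
    rewrite desE /des_from big_geq // (@dezE _ _ xpred0) => [|[]//].
    by rewrite big_ord0 !expr0 mulr1.
  (* Group the permutations by their set of non-fixed points, then by its size [n]. *)
  rewrite (partition_big (fun p : 'S_m => [tuple p i != i | i < m]) predT) //=.
  transitivity (\sum_(b : m.-tuple bool) \sum_(0 <= n < m.+1 | n == count id b)
      \sum_(q : 'S_n | derangement q) weight x y (perm_nat q) 0 false b).
    apply: eq_bigr => b _; rewrite (@sum_support _ _ _ (count id b)) //.
    have := count_size id b; rewrite size_tuple => le_bm.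
    by rewrite big_nat1_eq ifT // ltnS.
    rewrite (exchange_big_dep predT) //=; apply: eq_bigr => n _; rewrite exchange_big.
  apply: eq_bigr => q q_der; rewrite /term desE xdesE.
  rewrite -(@insertion_seriesE R x y (perm_nat q) n); first last.
  - by move=> i; apply: perm_nat_neq.
  - by move=> i; apply: perm_nat_lt.
  by apply: eq_bigl => b; rewrite eq_sym add0n.
pose F : fps R := \sum_(0 <= n < m.+1) \sum_(q : 'S_n | derangement q) term n q.
have {}sum_term : G_series x y m = (V * F) m.
  rewrite sum_term /F mulr_sumr fps_coef_sum; apply: eq_bigr => n _.
  by rewrite mulr_sumr fps_coef_sum.
(* Both sides are products with [V], so it suffices to match the coefficients [k <= m] of the other
   factors. *)
rewrite {}sum_term fps_coefM; apply: eq_bigr => i _; congr (_ * _).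
have : (m - i <= m)%N by apply: leq_subr.
move: (m - i)%N => k le_km.
have U0 : U 0%N = 0 by apply: fps_coefX0.
have -> : F k = \sum_(0 <= n < m.+1) \sum_(q : 'S_n | derangement q) term n q k.
  rewrite /F fps_coef_sum; apply: eq_bigr => n _.
  by rewrite fps_coef_sum.
rewrite /F_subst (@big_cat_nat _ _ _ k.+1) //=.
(* Terms with [n > k] vanish, as [U] has no constant term; [n = 0] then gives the leading 1 of
   [F_subst]. *)
rewrite [X in _ + X]big1_seq ?addr0; last first.
  move=> n; rewrite /= mem_index_iota => /andP[lt_kn _].
  by rewrite big1 // => q _; apply: fps_coefM_lt.
rewrite big_ltn // big_perm0 /term !expr0 !mulr1.
have -> : derangement (1%g : 'S_0) by apply/forallP => -[].
have -> : des (1%g : 'S_0) = 0%N by rewrite desE /des_from big_geq.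
have -> : xdes (1%g : 'S_0) = 0%N by rewrite xdesE /xdes_from big_geq.
rewrite !expr0 mulr1; congr (_ + _).
(* The term [n = 1] is empty: the only permutation of one point fixes it. *)
have -> : \sum_(1 <= n < k.+1) \sum_(q : 'S_n | derangement q) term n q k
    = \sum_(2 <= n < k.+1) \sum_(q : 'S_n | derangement q) term n q k.
  case: k {le_km} => [|k]; first by rewrite !big_geq.
  rewrite big_ltn // big1 ?add0r // => q /forallP/(_ ord0).
  by rewrite (ord1 (q ord0)).
apply: eq_bigr => n _; apply: eq_bigr => q _.
by rewrite !fps_powE.

Qed.
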